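(* Let ${\sf LocFin}_{\sf G}$ be the following formula about a countable graph $(V,E)$: $$\forall a\in V\ \exists k\ \ |\{b\in V:(a,b)\in E\}|\le k.$$ Then ${\sf LocFin}_{\sf G}$ is $\forall\forall^\infty\forall$-dicomplete.
   Context: Quantifiers range over $\omega$. $\exists^\infty n\,\varphi(n)$ means $\forall m\exists n\ge m\,\varphi(n)$ and $\forall^\infty n\,\varphi(n)$ means $\exists m\forall n\ge m\,\varphi(n)$. A quantifier-pattern is a finite string $\bar{\mathsf Q}=\mathsf Q_0\dots\mathsf Q_\ell$ over $\{\exists,\forall,\exists^\infty,\forall^\infty\}$. A $\bar{\mathsf Q}$-formula is $\varphi(\bar x)\equiv\mathsf Q_0n_0\dots\mathsf Q_\ell n_\ell\,\theta(n_0,\dots,n_\ell,\bar x)$ with $\theta$ a bounded formula. The instance $\bar x$ is a tuple of natural numbers and/or total computable functions (computable elements of $\omega^\omega$). Spaces such as $\omega\times\omega^\omega$, $(\omega^\omega)^\omega$, $\omega^{\omega\times\omega}$ are identified with $\omega^\omega$ by computable pairing. Witnesses: for $\alpha\in\omega^\omega$, $\alpha\Vdash\varphi(\bar x)$ (''$\alpha$ is a witness for $\varphi(\bar x)$'') is defined by: $\alpha\Vdash\theta(\bar x)$ iff $\alpha=\bar x$ and $\theta(\bar x)$, for bounded $\theta$; $\langle t,\alpha\rangle\Vdash\exists n\varphi(n,\bar x)$ iff $\alpha\Vdash\varphi(t,\bar x)$; $\alpha\Vdash\forall n\varphi(n,\bar x)$ iff $\alpha(n)\Vdash\varphi(n,\bar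 x)$ for all $n$; $\langle t,\alpha\rangle\Vdash\forall^\infty n\varphi(n,\bar x)$ iff $\alpha(n)\Vdash\varphi(n,\bar x)$ for all $n\ge t$; $\alpha\Vdash\exists^\infty n\varphi(n,\bar x)$ iff for all $n$, writing $\alpha(n)=\langle k,\beta\rangle$, $k\ge n$ and $\beta\Vdash\varphi(k,\bar x)$. Reducibility: $\varphi\le_{\sf m}\psi$ if there are computable functions $\eta,r_-,r_+$ (type-two computable functionals, possibly partial but defined wherever required) such that for every instance $\bar x$: $\varphi(\bar x)$ is true iff $\psi(\eta(\bar x))$ is true; $\alpha\Vdash\varphi(\bar x)$ implies $r_-(\alpha,\bar x)\Vdash\psi(\eta(\bar x))$; $\alpha\Vdash\psi(\eta(\bar x))$ implies $r_+(\alpha,\bar x)\Vdash\varphi(\bar x)$ ($\alpha\in\omega^\omega$ arbitrary). The dual $\varphi^{\sf d}$ of $\mathsf Q_0n_0\dots\mathsf Q_\ell n_\ell\,\theta$ is $\mathsf Q_0^{\sf d}n_0\dots\mathsf Q_\ell^{\sf d}n_\ell\,\neg\theta$, where $\exists^{\sf d}=\forall$, $\forall^{\sf d}=\exists$, $(\exists^\infty)^{\sf d}=\forall^\infty$, $(\forall^\infty)^{\sf d}=\exists^\infty$. $\varphi\le_{\sf dm}\psi$ if $\varphi\le_{\sf m}\psi$ and $\varphi^{\sf d}\le_{\sf m}\psi^{\sf d}$ via a common $\eta$ (the $r_\pm$ may differ). $\varphi$ is strictly $\bar{\mathsf Q}$-dicomplete if it is a $\bar{\mathsf Q}$-formula and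 $\psi\le_{\sf dm}\varphi$ for every $\bar{\mathsf Q}$-formula $\psi$; it is $\bar{\mathsf Q}$-dicomplete if it is $\equiv_{\sf dm}$-equivalent to a strictly $\bar{\mathsf Q}$-dicomplete formula (one such is $\mathsf Q_0n_0\dots\mathsf Q_\ell n_\ell.\ x(n_0,\dots,n_\ell)=0$). Structures: a countable binary relation $(X,R)$, $X\subseteq\omega$, $R\subseteq X^2$, is coded by the pair of characteristic functions of $X$ and $R$, and is identified with its code. Graphs are undirected. Instances of ${\sf LocFin}_{\sf G}$ are (computable) codes of graphs; reductions from it need only work on such codes and reductions to it must output such codes. Restricted quantifiers mean $\forall a(a\in V\to\cdots)$ etc., with decidable conditions moved into the innermost bounded part. For a set $A$, $|A|\le k$ abbreviates $\forall c_0,\dots,c_k\in A\ \exists i,j\le k\,(i\ne j\wedge c_i=c_j)$, where the block $\forall c_0,\dots,c_k$ is one universal quantifier over coded tuples. *)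

(* Defs.v *)
From Stdlib Require Import Arith List Cantor.
Import ListNotations.

(** * Type-two computability *)

Definition baire := nat -> nat.

Definition pairn (a b : nat) : nat := Cantor.to_nat (a, b).
Definition fstn (n : nat) : nat := fst (Cantor.of_nat n).
Definition sndn (n : nat) : nat := snd (Cantor.of_nat n).

(** Kleene's partial recursive functions relative to an oracle, presented as
    unary functions with the Cantor pairing in place of argument lists. *)
Inductive prog : Type :=
| PZero | PSucc | PFst | PSnd
| PQuery
| PPair (p q : prog)
| PComp (p q : prog)
| PRec (p q : prog)
| PMin (p : prog).

(** [eval o p n v]: program [p] with oracle [o] halts on [n] with value [v]. *)
Inductive eval (o : baire) : prog -> nat -> nat -> Prop :=
| EZero n : eval o PZero n 0
| ESucc n : eval o PSucc n (S n)
| EFst n : eval o PFst n (fstn n)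
| ESnd n : eval o PSnd n (sndn n)
| EQuery n : eval o PQuery n (o n)
| EPair p q n u v :
    eval o p n u -> eval o q n v -> eval o (PPair p q) n (pairn u v)
| EComp p q n u v :
    eval o q n u -> eval o p u v -> eval o (PComp p q) n v
| ERec0 p q a v :
    eval o p a v -> eval o (PRec p q) (pairn a 0) v
| ERecS p q a k u v :
    eval o (PRec p q) (pairn a k) u ->
    eval o q (pairn a (pairn k u)) v ->
    eval o (PRec p q) (pairn a (S k)) v
| EMin p a k (w : nat -> nat) :
    (forall j, j < k -> eval o p (pairn a j) (S (w j))) ->
    eval o p (pairn a k) 0 ->
    eval o (PMin p) a k.

(** The partial functional on Baire space given by [p] is defined at [a], with
    value [b]. *)
Definition computes (p : prog) (a b : baire) : Prop :=
  forall n, eval a p n (b n).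

Definition computable (f : baire) : Prop :=
  exists p, computes p (fun _ => 0) f.

(** * Coding of product spaces in Baire space *)

(** [omega * omega^omega]: the pair [<t, a>] is the sequence [t, a 0, a 1, ...];
    its components are [b 0] and [tail b]. *)
Definition scons (t : nat) (a : baire) : baire :=
  fun m => match m with 0 => t | S m' => a m' end.
Definition tail (a : baire) : baire := fun m => a (S m).

(** [(omega^omega)^omega]: the [n]-th component of [a]. *)
Definition row (a : baire) (n : nat) : baire := fun m => a (pairn n m).

(** Finite products of [omega^omega], padded with zero sequences:
    [row (bundle fs) j] is the [j]-th element of [fs]. *)
Definition bundle (fs : list baire) : baire :=
  fun m => nth (fstn m) fs (fun _ => 0) (sndn m).

Record instance : Type := Inst { nums : list nat; funs : list baire }.

Definition code (x : instance) : baire :=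
  fold_right scons (bundle (funs x)) (nums x).

Definition push (n : nat) (x : instance) : instance :=
  Inst (n :: nums x) (funs x).

(** * Bounded formulas *)

(** The sequence coded by [c] has the components [fstn c], [fstn (sndn c)],
    [fstn (sndn (sndn c))], ...; every finite tuple is an initial segment of a
    coded sequence, so a quantifier over [(k+1)]-tuples is a quantifier over [c]
    whose components [0], ..., [k] are used. *)
Definition component (c i : nat) : nat := fstn (Nat.iter i sndn c).

(** Terms of arithmetic with function parameters.  Number variables are de
    Bruijn indices.  The graphs of the coding functions are definable by bounded
    formulas of arithmetic and their values are bounded by polynomials, so
    having them as symbols does not enlarge the class of relations defined by
    bounded formulas. *)
Inductive term : Type :=
| TVar (i : nat)
| TZero
| TSucc (t : term)
| TAdd (t s : term)
| TMul (t s : term)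
| TPair (t s : term)
| TFst (t : term)
| TSnd (t : term)
| TComponent (t s : term)
| TApp (j : nat) (t : term).

Inductive bform : Type :=
| BEq (t s : term)
| BLe (t s : term)
| BNot (f : bform)
| BAnd (f g : bform)
| BOr (f g : bform)
| BImp (f g : bform)
| BAll (t : term) (f : bform)
| BEx (t : term) (f : bform).

(** Indices beyond the available variables denote [0] and the zero function. *)
Fixpoint teval (x : instance) (t : term) : nat :=
  match t with
  | TVar i => nth i (nums x) 0
  | TZero => 0
  | TSucc t => S (teval x t)
  | TAdd t s => teval x t + teval x s
  | TMul t s => teval x t * teval x s
  | TPair t s => pairn (teval x t) (teval x s)
  | TFst t => fstn (teval x t)
  | TSnd t => sndn (teval x t)
  | TComponent t s => component (teval x t) (teval x s)
  | TApp j t => nth j (funs x) (fun _ => 0) (teval x t)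
  end.

Fixpoint bholds (f : bform) (x : instance) : Prop :=
  match f with
  | BEq t s => teval x t = teval x s
  | BLe t s => teval x t <= teval x s
  | BNot f => ~ bholds f x
  | BAnd f g => bholds f x /\ bholds g x
  | BOr f g => bholds f x \/ bholds g x
  | BImp f g => bholds f x -> bholds g x
  | BAll t f => forall n, n <= teval x t -> bholds f (push n x)
  | BEx t f => exists n, n <= teval x t /\ bholds f (push n x)
  end.

(** * Quantifier patterns, formulas, witnesses *)

Inductive quant : Type := Ex | All | ExInf | AllInf.

Definition dual_quant (q : quant) : quant :=
  match q with Ex => All | All => Ex | ExInf => AllInf | AllInf => ExInf end.

(** A formula [Q_0 n_0 ... Q_l n_l. matrix] with [nnum] number parameters and
    [nfun] function parameters, asserted about the instances that satisfy
    [promise]. *)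
Record formula : Type := Formula {
  nnum : nat;
  nfun : nat;
  prefix : list quant;
  matrix : bform;
  promise : instance -> Prop
}.

Definition instance_of (phi : formula) (x : instance) : Prop :=
  length (nums x) = nnum phi /\ length (funs x) = nfun phi /\
  Forall computable (funs x) /\ promise phi x.

(** Each quantifier pushes its value in front of the instance, so in the matrix
    variable [0] is [n_l], the variable of the innermost quantifier. *)
Fixpoint qholds (Q : list quant) (f : bform) (x : instance) : Prop :=
  match Q with
  | [] => bholds f x
  | Ex :: Q' => exists n, qholds Q' f (push n x)
  | All :: Q' => forall n, qholds Q' f (push n x)
  | ExInf :: Q' => forall m, exists n, m <= n /\ qholds Q' f (push n x)
  | AllInf :: Q' => exists m, forall n, m <= n -> qholds Q' f (push n x)
  end.

Fixpoint qwitness (Q : list quant) (f : bform) (x : instance) (a : baire)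
    : Prop :=
  match Q with
  | [] => (forall m, a m = code x m) /\ bholds f x
  | Ex :: Q' => qwitness Q' f (push (a 0) x) (tail a)
  | All :: Q' => forall n, qwitness Q' f (push n x) (row a n)
  | ExInf :: Q' => forall n,
      n <= row a n 0 /\ qwitness Q' f (push (row a n 0) x) (tail (row a n))
  | AllInf :: Q' => forall n,
      a 0 <= n -> qwitness Q' f (push n x) (row (tail a) n)
  end.

Definition holds (phi : formula) (x : instance) : Prop :=
  qholds (prefix phi) (matrix phi) x.

Definition witness (phi : formula) (x : instance) (a : baire) : Prop :=
  qwitness (prefix phi) (matrix phi) x a.

Definition dual (phi : formula) : formula :=
  Formula (nnum phi) (nfun phi) (map dual_quant (prefix phi))
    (BNot (matrix phi)) (promise phi).

(** * Reducibility and completeness *)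

Definition reduces_via (eta rminus rplus : prog) (phi psi : formula) : Prop :=
  forall x, instance_of phi x ->
  exists y, instance_of psi y /\ computes eta (code x) (code y) /\
    (holds phi x <-> holds psi y) /\
    (forall a, witness phi x a ->
       exists b, computes rminus (bundle [a; code x]) b /\ witness psi y b) /\
    (forall a, witness psi y a ->
       exists b, computes rplus (bundle [a; code x]) b /\ witness phi x b).

Definition m_reducible (phi psi : formula) : Prop :=
  exists eta rminus rplus, reduces_via eta rminus rplus phi psi.

Definition dm_reducible (phi psi : formula) : Prop :=
  exists eta,
    (exists rminus rplus, reduces_via eta rminus rplus phi psi) /\
    (exists rminus rplus, reduces_via eta rminus rplus (dual phi) (dual psi)).

Definition dm_equivalent (phi psi : formula) : Prop :=
  dm_reducible phi psi /\ dm_reducible psi phi.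

Definition is_pattern_formula (Q : list quant) (phi : formula) : Prop :=
  prefix phi = Q /\ forall x, promise phi x.

Definition strictly_dicomplete (Q : list quant) (phi : formula) : Prop :=
  is_pattern_formula Q phi /\
  forall psi, is_pattern_formula Q psi -> dm_reducible psi phi.

Definition dicomplete (Q : list quant) (phi : formula) : Prop :=
  exists psi, strictly_dicomplete Q psi /\ dm_equivalent phi psi.

(** * Local finiteness of graphs *)

Definition is_characteristic (f : baire) : Prop :=
  forall n, f n = 0 \/ f n = 1.

(** The instance consists of the characteristic functions of the vertex set and
    of the edge relation.  Loops are not excluded. *)
Definition graph_instance (x : instance) : Prop :=
  exists chiV chiE : baire,
    x = Inst [] [chiV; chiE] /\
    is_characteristic chiV /\ is_characteristic chiE /\
    (forall a b, chiE (pairn a b) = 1 -> chiV a = 1 /\ chiV b = 1) /\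
    (forall a b, chiE (pairn a b) = 1 -> chiE (pairn b a) = 1).

Definition in_V (t : term) : bform := BEq (TApp 0 t) (TSucc TZero).
Definition in_E (t s : term) : bform := BEq (TApp 1 (TPair t s)) (TSucc TZero).

(** [a in V -> (forall i <= k, c_i in V /\ (a, c_i) in E) ->
     exists i j <= k, i <> j /\ c_i = c_j], where [c], [k], [a] are the variables
    [0], [1], [2] and are shifted under the bounded quantifiers. *)
Definition locfin_matrix : bform :=
  BImp (in_V (TVar 2))
    (BImp
      (BAll (TVar 1)
        (BAnd (in_V (TComponent (TVar 1) (TVar 0)))
              (in_E (TVar 3) (TComponent (TVar 1) (TVar 0)))))
      (BEx (TVar 1)
        (BEx (TVar 2)
          (BAnd (BNot (BEq (TVar 1) (TVar 0)))
                (BEq (TComponent (TVar 2) (TVar 1))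
                     (TComponent (TVar 2) (TVar 0))))))).

Definition LocFin_G : formula :=
  Formula 0 2 [All; Ex; All] locfin_matrix graph_instance.

(* Main.v *)
(** For a formula with prefix [All; q; All], where [q] is [Ex] or [AllInf], a
    witness amounts to a function [n |-> t] of valid values for the second
    quantifier, and a witness of the dual amounts to one number [n] without any
    valid [t]: the remaining values are found by unbounded search.  Hence a
    reduction in both senses only has to translate the pairs [(n, t)].

    To local finiteness we reduce [forall n, forall^oo m, forall k, f(n,m,k) = 0]
    by a disjoint union of stars whose [n]-th hub has degree at most [t] exactly
    when [f(n,m,k) = 0] for all [m >= t] and all [k], while leaves have degree
    at most [1].  Conversely, the matrix of [LocFin_G] is monotone in the degree
    bound [k], so [exists k] can be replaced by [forall^oo k]. *)

Require Import Defs.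
From Stdlib Require Import Arith Lia List Cantor Classical ClassicalEpsilon.
Import ListNotations.

(** * Projections of the Cantor pairing *)

Lemma fstn_pairn a b : fstn (pairn a b) = a.
Proof. unfold fstn, pairn. now rewrite cancel_of_to. Qed.

Lemma sndn_pairn a b : sndn (pairn a b) = b.
Proof. unfold sndn, pairn. now rewrite cancel_of_to. Qed.

Lemma pairn_fst_snd n : pairn (fstn n) (sndn n) = n.
Proof.
  unfold fstn, sndn, pairn. rewrite <- surjective_pairing. apply cancel_to_of.
Qed.

#[local] Hint Rewrite fstn_pairn sndn_pairn pairn_fst_snd : pairn.
Ltac unpair := autorewrite with pairn in *.

(** * Uniformly computable families *)

(** One program serves every index in [D] and sees [i] only through the oracle [ora i]. Maps on
    instances, and translations of a witness bundled with an instance, both take this form. *)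
Definition comp {I} (D : I -> Prop) (ora : I -> baire) (F : I -> baire) : Prop :=
  exists p, forall i, D i -> computes p (ora i) (F i).

Definition truth (P : Prop) : nat :=
  if excluded_middle_informative P then 1 else 0.

Definition decidable {I} (D : I -> Prop) (ora : I -> baire)
    (P : I -> nat -> Prop) : Prop :=
  comp D ora (fun i n => truth (P i n)).

Fixpoint subst_query (p q : prog) : prog :=
  match p with
  | PQuery => q
  | PPair p1 p2 => PPair (subst_query p1 q) (subst_query p2 q)
  | PComp p1 p2 => PComp (subst_query p1 q) (subst_query p2 q)
  | PRec p1 p2 => PRec (subst_query p1 q) (subst_query p2 q)
  | PMin p1 => PMin (subst_query p1 q)
  | _ => p
  end.

Lemma eval_subst_query o o' p q n v :
  computes q o o' -> eval o' p n v -> eval o (subst_query p q) n v.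
Proof.
  intros Hq H. induction H; cbn; try (econstructor; eassumption).
  apply Hq.
Qed.

(** Type-two functionals compose: each oracle query is replaced by a run of the program that
    computes the oracle. *)
Lemma comp_oracle {I J} (D : I -> Prop) (D' : J -> Prop) ora ora' F (h : I -> J) :
  comp D' ora' F -> (forall i, D i -> D' (h i)) ->
  comp D ora (fun i => ora' (h i)) -> comp D ora (fun i => F (h i)).
Proof.
  intros [p Hp] Hh [q Hq]. exists (subst_query p q). intros i Hi n.
  apply (eval_subst_query _ (ora' (h i))); [now apply Hq|].
  apply Hp; auto.
Qed.

Section Computability.
Context {I : Type} {D : I -> Prop} {ora : I -> baire}.
Implicit Types (F G A K T : I -> baire) (P Q : I -> nat -> Prop).

Lemma comp_ext F G :
  comp D ora F -> (forall i n, D i -> G i n = F i n) -> comp D ora G.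
Proof.
  intros [p Hp] H. exists p. intros i Hi n. rewrite H by easy. now apply Hp.
Qed.

Lemma comp_id : comp D ora (fun _ n => n).
Proof.
  (* [prog] has no identity program; pairing the two projections again gives one. *)
  exists (PPair PFst PSnd). intros i _ n. cbn beta.
  rewrite <- (pairn_fst_snd n) at 2. repeat constructor.
Qed.

Lemma comp_comp F G :
  comp D ora F -> comp D ora G -> comp D ora (fun i n => F i (G i n)).
Proof.
  intros [p Hp] [q Hq]. exists (PComp p q). intros i Hi n.
  econstructor; [now apply Hq|now apply Hp].
Qed.

Lemma comp_query G : comp D ora G -> comp D ora (fun i n => ora i (G i n)).
Proof. apply comp_comp. exists PQuery. intros i _ n. constructor. Qed.

Lemma comp_succ G : comp D ora G -> comp D ora (fun i n => S (G i n)).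
Proof.
  apply (comp_comp (fun _ n => S n)). exists PSucc. intros i _ n. constructor.
Qed.

Lemma comp_fst G : comp D ora G -> comp D ora (fun i n => fstn (G i n)).
Proof.
  apply (comp_comp (fun _ n => fstn n)). exists PFst. intros i _ n. constructor.
Qed.

Lemma comp_snd G : comp D ora G -> comp D ora (fun i n => sndn (G i n)).
Proof.
  apply (comp_comp (fun _ n => sndn n)). exists PSnd. intros i _ n. constructor.
Qed.

Lemma comp_const c : comp D ora (fun _ _ => c).
Proof.
  induction c; [exists PZero; intros i _ n; constructor|now apply comp_succ].
Qed.

Lemma comp_pair F G :
  comp D ora F -> comp D ora G -> comp D ora (fun i n => pairn (F i n) (G i n)).
Proof.
  intros [p Hp] [q Hq]. exists (PPair p q). intros i Hi n.
  constructor; [now apply Hp|now apply Hq].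
Qed.

Lemma comp_rec A (B : I -> nat -> nat -> nat -> nat) K :
  comp D ora A ->
  comp D ora (fun i z => B i (fstn z) (fstn (sndn z)) (sndn (sndn z))) ->
  comp D ora K ->
  comp D ora (fun i n => nat_rec _ (A i n) (B i n) (K i n)).
Proof.
  intros [p Hp] [q Hq] HK.
  (* [PRec] reads parameter and counter from one input, so the recursion is first computed on a
     paired input [z] and then composed with the pair of [n] and [K i n]. *)
  assert (H : comp D ora
    (fun i z => nat_rec _ (A i (fstn z)) (B i (fstn z)) (sndn z))).
  { exists (PRec p q). intros i Hi z.
    rewrite <- (pairn_fst_snd z) at 1. generalize (fstn z), (sndn z).
    intros a k. induction k as [|k IH]; cbn.
    - constructor. now apply Hp.
    - econstructor; [exact IH|].
      specialize (Hq i Hi (pairn a (pairn k (nat_rec _ (A i a) (B i a) k)))).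
      cbn beta in Hq. now unpair. }
  eapply comp_ext; [exact (comp_comp _ _ H (comp_pair _ _ comp_id HK))|].
  intros i n _. cbn beta. now unpair.
Qed.

Lemma comp_case A (B : I -> nat -> nat -> nat) K :
  comp D ora A -> comp D ora (fun i z => B i (fstn z) (sndn z)) ->
  comp D ora K ->
  comp D ora (fun i n => match K i n with 0 => A i n | S k => B i n k end).
Proof.
  intros HA HB HK.
  (* A case distinction is a recursion that ignores the previous value. *)
  eapply comp_ext; [apply (comp_rec A (fun i n k _ => B i n k) K HA)|].
  - eapply comp_ext; [eapply comp_comp; [exact HB|]|].
    + apply comp_pair; [|apply comp_fst, comp_snd]; [apply comp_fst|]; apply comp_id.
    + intros i n _. cbn beta. now unpair.
  - exact HK.
  - intros i n _. cbn beta. now destruct (K i n).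
Qed.

Lemma comp_scons T (g : I -> nat -> baire) K :
  comp D ora T -> comp D ora (fun i z => g i (fstn z) (sndn z)) ->
  comp D ora K -> comp D ora (fun i n => scons (T i n) (g i n) (K i n)).
Proof. apply comp_case. Qed.

Lemma comp_iter (f : nat -> nat) F K :
  comp D ora (fun _ => f) -> comp D ora F -> comp D ora K ->
  comp D ora (fun i n => Nat.iter (K i n) f (F i n)).
Proof.
  intros Hf HF HK. apply (comp_rec F (fun _ _ _ u => f u) K HF); [|exact HK].
  apply (comp_comp (fun _ => f)); [exact Hf|].
  apply comp_snd, comp_snd, comp_id.
Qed.

Lemma comp_add F G :
  comp D ora F -> comp D ora G -> comp D ora (fun i n => F i n + G i n).
Proof.
  intros HF HG. eapply comp_ext; [apply (comp_iter S G F);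
    [apply comp_succ, comp_id|exact HG|exact HF]|].
  intros i n _. cbn beta. induction (F i n); cbn; auto.
Qed.

Lemma comp_mul F G :
  comp D ora F -> comp D ora G -> comp D ora (fun i n => F i n * G i n).
Proof.
  intros HF HG.
  eapply comp_ext; [apply (comp_rec (fun _ _ => 0) (fun i n _ u => G i n + u) F)|].
  - apply comp_const.
  - apply comp_add; [apply (comp_comp _ _ HG), comp_fst, comp_id|].
    apply comp_snd, comp_snd, comp_id.
  - exact HF.
  - intros i n _. cbn beta. induction (F i n); cbn; auto.
Qed.

Lemma comp_sub F G :
  comp D ora F -> comp D ora G -> comp D ora (fun i n => F i n - G i n).
Proof.
  intros HF HG. eapply comp_ext; [apply (comp_iter pred F G); [|exact HF|exact HG]|].
  - eapply comp_ext.
    + apply (comp_case (fun _ _ => 0) (fun _ _ k => k) (fun _ n => n)).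
      * apply comp_const.
      * apply comp_snd, comp_id.
      * apply comp_id.
    + now intros i [|n] _.
  - intros i n _. cbn beta. induction (G i n) as [|k IH].
    + apply Nat.sub_0_r.
    + now rewrite Nat.sub_succ_r, IH.
Qed.

Lemma comp_component F G :
  comp D ora F -> comp D ora G ->
  comp D ora (fun i n => component (F i n) (G i n)).
Proof.
  intros HF HG. apply comp_fst, comp_iter; auto. apply comp_snd, comp_id.
Qed.

(** * Decidable predicates and unbounded search *)

Lemma decidable_comp P G :
  decidable D ora P -> comp D ora G -> decidable D ora (fun i n => P i (G i n)).
Proof. intros HP. apply (comp_comp _ _ HP). Qed.

Lemma decidable_ext P Q :
  decidable D ora P -> (forall i n, D i -> Q i n <-> P i n) -> decidable D ora Q.
Proof.
  intros HP H. apply (comp_ext _ _ HP). intros i n Hi.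
  specialize (H i n Hi). unfold truth.
  do 2 destruct excluded_middle_informative; tauto.
Qed.

Lemma decidable_zero F : comp D ora F -> decidable D ora (fun i n => F i n = 0).
Proof.
  intros HF.
  eapply comp_ext; [apply (comp_case (fun _ _ => 1) (fun _ _ _ => 0) F)|].
  - apply comp_const.
  - apply comp_const.
  - exact HF.
  - intros i n _. cbn beta. unfold truth.
    now destruct excluded_middle_informative, (F i n).
Qed.

Lemma decidable_le F G :
  comp D ora F -> comp D ora G -> decidable D ora (fun i n => F i n <= G i n).
Proof.
  intros HF HG. apply (decidable_ext _ _ (decidable_zero _ (comp_sub _ _ HF HG))).
  intros i n _. lia.
Qed.

Lemma decidable_not P : decidable D ora P -> decidable D ora (fun i n => ~ P i n).
Proof.
  intros HP. apply (decidable_ext _ _ (decidable_zero _ HP)).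
  intros i n _. unfold truth. destruct excluded_middle_informative; [|tauto].
  split; [tauto|discriminate].
Qed.

Lemma decidable_and P Q :
  decidable D ora P -> decidable D ora Q ->
  decidable D ora (fun i n => P i n /\ Q i n).
Proof.
  intros HP HQ. eapply comp_ext; [exact (comp_mul _ _ HP HQ)|].
  intros i n _. cbn beta. unfold truth.
  repeat destruct excluded_middle_informative; tauto.
Qed.

Lemma decidable_or P Q :
  decidable D ora P -> decidable D ora Q ->
  decidable D ora (fun i n => P i n \/ Q i n).
Proof.
  intros HP HQ.
  eapply decidable_ext; [apply decidable_not, (decidable_and _ _
    (decidable_not _ HP) (decidable_not _ HQ))|].
  intros i n _. cbn beta. tauto.
Qed.

Lemma decidable_imp P Q :
  decidable D ora P -> decidable D ora Q ->
  decidable D ora (fun i n => P i n -> Q i n).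
Proof.
  intros HP HQ.
  eapply decidable_ext; [apply (decidable_or _ _ (decidable_not _ HP) HQ)|].
  intros i n _. cbn beta. tauto.
Qed.

Lemma decidable_eq F G :
  comp D ora F -> comp D ora G -> decidable D ora (fun i n => F i n = G i n).
Proof.
  intros HF HG.
  eapply decidable_ext; [apply decidable_and; apply decidable_le;
    [exact HF|exact HG|exact HG|exact HF]|].
  intros i n _. cbn beta. lia.
Qed.

(** The truth value is the product of the truth values up to the bound. The bound variable is the
    first component of [z], matching the order in which [pushes] unpacks a tuple. *)
Lemma decidable_ball (P : I -> nat -> nat -> Prop) K :
  decidable D ora (fun i z => P i (sndn z) (fstn z)) -> comp D ora K ->
  decidable D ora (fun i n => forall k, k <= K i n -> P i n k).
Proof.
  intros HP HK.
  eapply comp_ext.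
  - apply (comp_rec (fun i n => truth (P i n 0))
             (fun i n k u => truth (P i n (S k)) * u) K).
    + eapply comp_ext; [eapply comp_comp;
        [exact HP|apply (comp_pair _ _ (comp_const 0) comp_id)]|].
      intros i n _. cbn beta. now unpair.
    + apply comp_mul; [|apply comp_snd, comp_snd, comp_id].
      eapply comp_ext; [eapply comp_comp; [exact HP|apply comp_pair]|].
      * apply comp_succ, comp_fst, comp_snd, comp_id.
      * apply comp_fst, comp_id.
      * intros i n _. cbn beta. now unpair.
    + exact HK.
  - intros i n _. cbn beta. induction (K i n) as [|k IH]; cbn.
    + unfold truth.
      destruct excluded_middle_informative as [H1|H1],
        excluded_middle_informative as [H2|H2]; auto; exfalso; auto.
      apply H1. intros k Hk. now replace k with 0 by lia.
    + rewrite <- IH. unfold truth.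
      destruct excluded_middle_informative as [H1|H1],
        excluded_middle_informative as [H2|H2],
        excluded_middle_informative as [H3|H3]; auto; exfalso; auto.
      apply H1. intros j Hj. destruct (Nat.eq_dec j (S k)) as [->|]; auto.
      apply H3. lia.
Qed.

Lemma decidable_bex (P : I -> nat -> nat -> Prop) K :
  decidable D ora (fun i z => P i (sndn z) (fstn z)) -> comp D ora K ->
  decidable D ora (fun i n => exists k, k <= K i n /\ P i n k).
Proof.
  intros HP HK.
  eapply decidable_ext;
    [apply decidable_not, (decidable_ball (fun i n k => ~ P i n k) K); auto|].
  - now apply decidable_not.
  - intros i n _. cbn beta. split.
    + intros [k [Hk Hp]] H. now apply (H k).
    + intros H. apply NNPP. intros H'. apply H. intros k Hk Hp. eauto.
Qed.

Lemma comp_search P :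
  decidable D ora P -> (forall i, D i -> forall n, exists v, P i (pairn n v)) ->
  exists F, comp D ora F /\ forall i, D i -> forall n, P i (pairn n (F i n)).
Proof.
  (* [PMin] looks for a zero, and the truth value of the negation vanishes exactly where [P]
     holds. *)
  intros HP Hex. destruct (decidable_not _ HP) as [q Hq].
  set (least i n v := P i (pairn n v) /\ forall j, j < v -> ~ P i (pairn n j)).
  assert (Hl : forall i, D i -> forall n, exists v, least i n v).
  { intros i Hi n. destruct (Hex i Hi n) as [v Hv].
    induction v as [v IH] using lt_wf_ind.
    destruct (classic (exists j, j < v /\ P i (pairn n j))) as [[j [Hj Hp]]|H].
    - now apply (IH j).
    - exists v. split; [easy|]. intros j Hj Hp. apply H. eauto. }
  (* [epsilon] only names the value; leastness makes it the one at which [PMin] halts. *)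
  exists (fun i n => epsilon (inhabits 0) (least i n)).
  split; [exists (PMin q)|]; intros i Hi n; specialize (Hl i Hi n);
    destruct (epsilon_spec (inhabits 0) _ Hl) as [H1 H2]; [|exact H1].
  (* Before the least solution the negation has truth value [1], the successor of [0]. *)
  apply EMin with (w := fun _ => 0).
  - intros j Hj. specialize (Hq i Hi (pairn n j)). specialize (H2 j Hj).
    unfold truth in Hq. now destruct excluded_middle_informative.
  - match goal with |- eval _ _ ?z 0 => specialize (Hq i Hi z) end.
    unfold truth in Hq. now destruct excluded_middle_informative.
Qed.

End Computability.

(** * Deciding bounded formulas from the code of an instance *)

(** The values of [d] bound variables are packed into the single number [e], so that truth of a
    bounded formula becomes a unary predicate of [e]. Component [i] of [e] is de Bruijn variable
    [i]. *)
Fixpoint pushes (d e : nat) (x : instance) : instance :=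
  match d with
  | 0 => x
  | S d => push (fstn e) (pushes d (sndn e) x)
  end.

Lemma funs_pushes d e x : funs (pushes d e x) = funs x.
Proof. revert e. induction d; cbn; auto. Qed.

Lemma nth_pushes d e x i :
  nth i (nums (pushes d e x)) 0 =
  if i <? d then component e i else nth (i - d) (nums x) 0.
Proof.
  revert e i. induction d as [|d IH]; intros e i.
  - cbn. now rewrite Nat.sub_0_r.
  - destruct i as [|i]; [reflexivity|].
    change (nth i (nums (pushes d (sndn e) x)) 0 =
      if i <? d then component e (S i) else nth (i - d) (nums x) 0).
    rewrite IH. unfold component. now rewrite Nat.iter_succ_r.
Qed.

Lemma code_nums x i : i < length (nums x) -> code x i = nth i (nums x) 0.
Proof.
  destruct x as [ns fs]; unfold code; cbn. revert i.
  induction ns as [|n ns IH]; intros i Hi; cbn in *; [lia|].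
  destruct i; [reflexivity|]. apply IH. lia.
Qed.

Lemma code_funs x m : code x (length (nums x) + m) = bundle (funs x) m.
Proof. destruct x as [ns fs]; unfold code; cbn. induction ns; cbn; auto. Qed.

Lemma bundle_pairn fs j m : bundle fs (pairn j m) = nth j fs (fun _ => 0) m.
Proof. unfold bundle. now unpair. Qed.

Lemma comp_teval nn d t :
  comp (fun x => length (nums x) = nn) code (fun x e => teval (pushes d e x) t).
Proof.
  induction t as [i| |t IHt|t IHt s IHs|t IHt s IHs|t IHt s IHs|t IHt|t IHt
    |t IHt s IHs|j t IHt]; cbn.
  (* A variable is a component of the packed tuple, or a number stored in the oracle, or out of
     range with default value [0]. *)
  - destruct (Nat.ltb_spec i d) as [H|H];
      [|destruct (Nat.ltb_spec (i - d) nn) as [H'|H']].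
    + eapply comp_ext; [apply (comp_component _ _ comp_id (comp_const i))|].
      intros x e _. cbn beta. rewrite nth_pushes.
      now apply Nat.ltb_lt in H as ->.
    + eapply comp_ext; [apply (comp_query _ (comp_const (i - d)))|].
      intros x e Hx. cbn beta. rewrite nth_pushes.
      apply Nat.ltb_ge in H as ->. rewrite code_nums; [easy|lia].
    + eapply comp_ext; [apply (comp_const 0)|].
      intros x e Hx. rewrite nth_pushes. apply Nat.ltb_ge in H as ->.
      apply nth_overflow. lia.
  - apply comp_const.
  - now apply comp_succ.
  - now apply comp_add.
  - now apply comp_mul.
  - now apply comp_pair.
  - now apply comp_fst.
  - now apply comp_snd.
  - now apply comp_component.
  - eapply comp_ext.
    (* In the code, the function parameters start after the [nn] numbers. *)
    + apply (comp_query _ (comp_add _ _ (comp_const nn)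
               (comp_pair _ _ (comp_const j) IHt))).
    + intros x e <-. cbn beta. rewrite code_funs, bundle_pairn.
      now rewrite funs_pushes.
Qed.

Lemma decidable_bholds nn d f :
  decidable (fun x => length (nums x) = nn) code
    (fun x e => bholds f (pushes d e x)).
Proof.
  revert d. induction f as [t s|t s|f IHf|f IHf g IHg|f IHf g IHg|f IHf g IHg
    |t f IHf|t f IHf]; intros d; cbn.
  - apply decidable_eq; apply comp_teval.
  - apply decidable_le; apply comp_teval.
  - now apply decidable_not.
  - now apply decidable_and.
  - now apply decidable_or.
  - now apply decidable_imp.
  (* The quantified variable joins the front of the packed tuple, so the induction hypothesis is
     used at depth [S d]. *)
  - apply (decidable_ball (fun x e n => bholds f (push n (pushes d e x))));
      [apply (IHf (S d))|apply comp_teval].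
  - apply (decidable_bex (fun x e n => bholds f (push n (pushes d e x))));
      [apply (IHf (S d))|apply comp_teval].
Qed.

Lemma decidable_bholds_family {I} (D : I -> Prop) ora (X : I -> instance) nn d f
    (E : I -> baire) :
  comp D ora (fun i => code (X i)) -> (forall i, D i -> length (nums (X i)) = nn) ->
  comp D ora E -> decidable D ora (fun i n => bholds f (pushes d (E i n) (X i))).
Proof.
  intros HX Hn HE.
  apply (decidable_comp (fun i e => bholds f (pushes d e (X i))) E); [|exact HE].
  apply (comp_oracle D (fun x => length (nums x) = nn) ora code
    (fun x n => truth (bholds f (pushes d n x))) X); auto.
  apply decidable_bholds.
Qed.

(** * Computability of bundles and codes *)

Lemma computable_iff f :
  computable f <-> comp (fun _ : unit => True) (fun _ _ => 0) (fun _ => f).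
Proof.
  split; intros [p Hp]; exists p; [intros _ _; exact Hp|exact (Hp tt Logic.I)].
Qed.

(** The common length [l] leaves finitely many programs to combine: a case distinction on the row
    number runs the one for the head or passes to the tail. *)
Lemma comp_bundle {I} (D : I -> Prop) ora (fs : I -> list baire) l :
  (forall i, D i -> length (fs i) = l) ->
  (forall j, comp D ora (fun i => nth j (fs i) (fun _ => 0))) ->
  comp D ora (fun i => bundle (fs i)).
Proof.
  revert fs. induction l as [|l IH]; intros fs Hl H.
  - eapply comp_ext; [apply (comp_const 0)|].
    intros i n Hi. specialize (Hl i Hi). destruct (fs i); [|easy].
    unfold bundle. now destruct (fstn n).
  - eapply comp_ext.
    + apply (comp_case (fun i m => nth 0 (fs i) (fun _ => 0) (sndn m))
        (fun i m j => bundle (List.tl (fs i)) (pairn j (sndn m)))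
        (fun _ m => fstn m)).
      * apply (comp_comp _ _ (H 0)), comp_snd, comp_id.
      * apply (comp_comp (fun i => bundle (List.tl (fs i)))).
        -- apply IH.
           ++ intros i Hi. specialize (Hl i Hi). destruct (fs i); cbn in *; lia.
           ++ intros j. eapply comp_ext; [apply (H (S j))|].
              intros i n _. cbn beta. destruct (fs i); [now destruct j|easy].
        -- apply comp_pair; [|apply comp_snd, comp_fst]; [apply comp_snd|];
             apply comp_id.
      * apply comp_fst, comp_id.
    + intros i n Hi. specialize (Hl i Hi). cbn beta. destruct (fs i); [easy|].
      destruct (fstn n) eqn:E; [|rewrite bundle_pairn];
        unfold bundle; now rewrite E.
Qed.

Lemma computable_bundle fs : Forall computable fs -> computable (bundle fs).
Proof.
  intros H. apply computable_iff.
  apply (comp_bundle _ _ (fun _ => fs) (length fs)); [easy|].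
  intros j. apply computable_iff. destruct (Nat.lt_ge_cases j (length fs)) as [Hj|Hj].
  - rewrite Forall_forall in H. now apply H, nth_In.
  - rewrite nth_overflow by easy. exists PZero. intros n. constructor.
Qed.

Lemma computable_code x : Forall computable (funs x) -> computable (code x).
Proof.
  destruct x as [ns fs]; unfold code; cbn. intros H%computable_bundle.
  induction ns as [|n ns IH]; cbn; [easy|].
  rewrite computable_iff in *.
  apply (comp_scons (fun _ _ => n) (fun _ _ => fold_right scons (bundle fs) ns)
    (fun _ m => m)); [apply comp_const| |apply comp_id].
  apply (comp_comp _ _ IH), comp_snd, comp_id.
Qed.

(** At a fixed index a computable oracle can be simulated. This shows that the instances produced by
    a reduction again have computable function parameters. *)
Lemma computable_family {I} (D : I -> Prop) ora (F : I -> baire) i :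
  comp D ora F -> D i -> computable (ora i) -> computable (F i).
Proof.
  intros HF Hi Ho. rewrite computable_iff in *.
  exact (comp_oracle _ D _ ora F (fun _ => i) HF (fun _ _ => Hi) Ho).
Qed.

(** * Formulas with prefix [All; q; All] *)

(** Meaningful for [q = Ex] and [q = AllInf] only. *)
Definition settled (q : quant) (f : bform) (x : instance) (n t : nat) : Prop :=
  match q with
  | Ex => forall k, bholds f (push k (push t (push n x)))
  | _ => forall m, t <= m -> forall k, bholds f (push k (push m (push n x)))
  end.

Lemma qholds_settled q f x :
  q = Ex \/ q = AllInf ->
  qholds [All; q; All] f x <-> forall n, exists t, settled q f x n t.
Proof. intros [-> | ->]; reflexivity. Qed.

(** Classical De Morgan laws: below the outer quantifier, the dual formula exhibits, for each [t], a
    counterexample to [t] being valid. *)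
Lemma qholds_dual_settled q f x :
  q = Ex \/ q = AllInf ->
  qholds (map dual_quant [All; q; All]) (BNot f) x <->
  exists n, forall t, ~ settled q f x n t.
Proof.
  intros [-> | ->]; split; intros [n H]; exists n; intros t; cbn in *.
  - intros Hs. destruct (H t) as [k Hk]. auto.
  - now apply not_all_ex_not, H.
  - intros Hs. destruct (H t) as [m [Hm [k Hk]]]. now apply Hk, Hs.
  - apply NNPP. intros H'. apply (H t). intros m Hm k. apply NNPP.
    intros Hk. apply H'. now exists m; split; [|exists k].
Qed.

(** Entry [0] of row [n] is the chosen value for [Ex] and the threshold for [AllInf]; the rest of
    the row confirms it. *)
Lemma qwitness_settled q f x a n :
  q = Ex \/ q = AllInf ->
  qwitness [All; q; All] f x a -> settled q f x n (a (pairn n 0)).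
Proof.
  intros [-> | ->] H.
  - intros k. apply (H n).
  - intros m Hm k. now apply (H n).
Qed.

Lemma qwitness_dual_settled q f x a t :
  q = Ex \/ q = AllInf ->
  qwitness (map dual_quant [All; q; All]) (BNot f) x a ->
  ~ settled q f x (a 0) t.
Proof.
  intros [-> | ->] H Hs.
  - destruct (H t) as [_ Hk]. apply Hk, Hs.
  - destruct (H t) as [Hm [_ Hk]]. now apply Hk, Hs.
Qed.

(** * Building witnesses from the values of the quantifiers *)

Ltac unseq :=
  unfold row, Defs.tail in *; repeat (progress (unpair; cbn [scons] in *)).

Section Witnesses.
Context {I : Type} {D : I -> Prop} {ora : I -> baire}.

(** Pairing the argument of [N] and [X] with the position in the code lets the lemma be applied
    repeatedly, once for each pushed number. *)
Lemma comp_code_push (X : I -> nat -> instance) (N : I -> baire) :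
  comp D ora N ->
  comp D ora (fun i z => code (X i (fstn z)) (sndn z)) ->
  comp D ora (fun i z => code (push (N i (fstn z)) (X i (fstn z))) (sndn z)).
Proof.
  intros HN HX.
  apply (comp_scons (fun i z => N i (fstn z)) (fun i z => code (X i (fstn z)))).
  - apply (comp_comp _ _ HN), comp_fst, comp_id.
  - eapply comp_ext; [eapply comp_comp; [exact HX|]|].
    + apply (comp_pair _ _ (comp_fst _ (comp_fst _ comp_id)) (comp_snd _ comp_id)).
    + intros i z _. cbn beta. now unpair.
  - apply comp_snd, comp_id.
Qed.

Lemma comp_code_push3 (Y : I -> instance) (N M K J : I -> baire) :
  comp D ora (fun i => code (Y i)) ->
  comp D ora N -> comp D ora M -> comp D ora K -> comp D ora J ->
  comp D ora
    (fun i z => code (push (K i z) (push (M i z) (push (N i z) (Y i)))) (J i z)).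
Proof.
  intros HY HN HM HK HJ.
  eapply comp_ext; [eapply comp_comp; [|exact (comp_pair _ _ comp_id HJ)]|].
  - apply (comp_code_push (fun i z => push (M i z) (push (N i z) (Y i))) K HK).
    apply (comp_code_push (fun i z => push (N i z) (Y i)) M HM).
    apply (comp_code_push (fun i z => Y i) N HN).
    apply (comp_comp _ _ HY), comp_snd, comp_id.
  - intros i z _. cbn beta. now unpair.
Qed.

(** Once [T] is given, only universally quantified values and the code of the extended instance
    remain to be written, so no search occurs. *)
Lemma comp_witness q f (Y : I -> instance) (T : I -> baire) :
  q = Ex \/ q = AllInf ->
  comp D ora (fun i => code (Y i)) -> comp D ora T ->
  (forall i, D i -> forall n, settled q f (Y i) n (T i n)) ->
  exists F, comp D ora F /\ forall i, D i -> qwitness [All; q; All] f (Y i) (F i).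
Proof.
  intros Hq HY HT Hs.
  set (leaf i n m k := code (push k (push m (push n (Y i))))).
  destruct Hq as [-> | ->].
  (* Row [n] holds the value [T i n], followed by one code for each [k]. *)
  - exists (fun i z => scons (T i (fstn z))
      (fun r => leaf i (fstn z) (T i (fstn z)) (fstn r) (sndn r)) (sndn z)).
    split.
    + apply comp_scons with (T := fun i z => T i (fstn z))
        (g := fun i z r => leaf i (fstn z) (T i (fstn z)) (fstn r) (sndn r)).
      * apply (comp_comp _ _ HT), comp_fst, comp_id.
      * apply (comp_code_push3 Y (fun i z => fstn (fstn z))
          (fun i z => T i (fstn (fstn z))) (fun i z => fstn (sndn z))
          (fun i z => sndn (sndn z))); [exact HY| | | |].
        -- apply comp_fst, comp_fst, comp_id.
        -- apply (comp_comp _ _ HT), comp_fst, comp_fst, comp_id.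
        -- apply comp_fst, comp_snd, comp_id.
        -- apply comp_snd, comp_snd, comp_id.
      * apply comp_snd, comp_id.
    + intros i Hi n k. unseq.
      split; [|apply (Hs i Hi n)].
      intros j. now unseq.
  (* Row [n] holds the threshold [T i n], followed by codes for all [m] and [k]; entries with [m]
     below the threshold are filled in the same way. *)
  - exists (fun i z => scons (T i (fstn z))
      (fun r => leaf i (fstn z) (fstn r) (fstn (sndn r)) (sndn (sndn r)))
      (sndn z)).
    split.
    + apply comp_scons with (T := fun i z => T i (fstn z))
        (g := fun i z r =>
          leaf i (fstn z) (fstn r) (fstn (sndn r)) (sndn (sndn r))).
      * apply (comp_comp _ _ HT), comp_fst, comp_id.
      * apply (comp_code_push3 Y (fun i z => fstn (fstn z))
          (fun i z => fstn (sndn z)) (fun i z => fstn (sndn (sndn z)))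
          (fun i z => sndn (sndn (sndn z)))); [exact HY| | | |].
        -- apply comp_fst, comp_fst, comp_id.
        -- apply comp_fst, comp_snd, comp_id.
        -- apply comp_fst, comp_snd, comp_snd, comp_id.
        -- apply comp_snd, comp_snd, comp_snd, comp_id.
      * apply comp_snd, comp_id.
    + intros i Hi n m Hm k. unseq.
      split; [|now apply (Hs i Hi n)].
      intros j. now unseq.
Qed.

(* Past its first value, a witness for the dual formula is found by search. *)
Lemma comp_dual_witness q f (Y : I -> instance) nn (N : I -> nat) :
  q = Ex \/ q = AllInf ->
  comp D ora (fun i => code (Y i)) -> comp D ora (fun i _ => N i) ->
  (forall i, D i -> length (nums (Y i)) = nn) ->
  (forall i, D i -> forall t, ~ settled q f (Y i) (N i) t) ->
  exists F, comp D ora F /\ forall i, D i ->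
    qwitness (map dual_quant [All; q; All]) (BNot f) (Y i) (F i).
Proof.
  intros Hq HY HN Hlen Hs.
  (* The tuple is packed so that [pushes 3] restores [K], [M], [N] as variables [0], [1], [2]. *)
  set (env := fun (M K : I -> baire) i z =>
    pairn (K i z) (pairn (M i z) (pairn (N i) 0))).
  assert (Hdec : forall M K, comp D ora M -> comp D ora K -> decidable D ora
    (fun i z => ~ bholds f (pushes 3 (env M K i z) (Y i)))).
  { intros M K HM HK. apply decidable_not.
    apply (decidable_bholds_family D ora Y nn); auto.
    repeat apply comp_pair; auto using comp_const. }
  destruct Hq as [-> | ->].
  - destruct (comp_search _ (Hdec (fun _ z => fstn z) (fun _ z => sndn z)
      (comp_fst _ comp_id) (comp_snd _ comp_id))) as [C [HC HCs]].
    { intros i Hi m. specialize (Hs i Hi m).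
      apply not_all_ex_not in Hs as [k Hk]. exists k.
      cbn [pushes]. unfold env. now unpair. }
    exists (fun i => scons (N i) (fun z => scons (C i (fstn z))
      (code (push (C i (fstn z)) (push (fstn z) (push (N i) (Y i)))))
      (sndn z))).
    split.
    + apply comp_scons with (T := fun i z => N i) (K := fun _ z => z)
        (g := fun i _ z => scons (C i (fstn z))
          (code (push (C i (fstn z)) (push (fstn z) (push (N i) (Y i)))))
          (sndn z)); [exact HN| |apply comp_id].
      apply comp_scons with (T := fun i z => C i (fstn (sndn z)))
        (K := fun _ z => sndn (sndn z))
        (g := fun i z => code (push (C i (fstn (sndn z)))
                (push (fstn (sndn z)) (push (N i) (Y i))))).
      * apply (comp_comp _ _ HC), comp_fst, comp_snd, comp_id.
      * apply (comp_code_push3 Y (fun i _ => N i)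
          (fun _ z => fstn (sndn (fstn z))) (fun i z => C i (fstn (sndn (fstn z))))
          (fun _ z => sndn z)); [exact HY|exact HN| | |].
        -- apply comp_fst, comp_snd, comp_fst, comp_id.
        -- apply (comp_comp _ _ HC), comp_fst, comp_snd, comp_fst, comp_id.
        -- apply comp_snd, comp_id.
      * apply comp_snd, comp_snd, comp_id.
    + intros i Hi m. unseq.
      split; [|specialize (HCs i Hi m); cbn [pushes] in HCs; unfold env in HCs;
        now unpair].
      intros j. now unseq.
  (* Both [m] and [k] are now to be found, with [m] at least the given bound; they are searched for
     as one pair. *)
  - assert (Hdec' : decidable D ora (fun i z => fstn z <= fstn (sndn z) /\
      ~ bholds f (pushes 3 (env (fun _ z => fstn (sndn z))
          (fun _ z => sndn (sndn z)) i z) (Y i)))).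
    { apply decidable_and; [apply decidable_le|apply Hdec].
      - apply comp_fst, comp_id.
      - apply comp_fst, comp_snd, comp_id.
      - apply comp_fst, comp_snd, comp_id.
      - apply comp_snd, comp_snd, comp_id. }
    destruct (comp_search _ Hdec') as [C [HC HCs]].
    { intros i Hi t. specialize (Hs i Hi t). cbn in Hs.
      apply not_all_ex_not in Hs as [m Hm].
      apply imply_to_and in Hm as [Htm Hm].
      apply not_all_ex_not in Hm as [k Hk].
      exists (pairn m k). cbn [pushes]. unfold env. now unpair. }
    exists (fun i => scons (N i) (fun z => scons (fstn (C i (fstn z)))
      (scons (sndn (C i (fstn z)))
        (code (push (sndn (C i (fstn z))) (push (fstn (C i (fstn z)))
          (push (N i) (Y i))))))
      (sndn z))).
    split.
    + apply comp_scons with (T := fun i z => N i) (K := fun _ z => z)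
        (g := fun i _ z => scons (fstn (C i (fstn z)))
          (scons (sndn (C i (fstn z)))
            (code (push (sndn (C i (fstn z))) (push (fstn (C i (fstn z)))
              (push (N i) (Y i))))))
          (sndn z)); [exact HN| |apply comp_id].
      apply comp_scons with (T := fun i z => fstn (C i (fstn (sndn z))))
        (K := fun _ z => sndn (sndn z))
        (g := fun i z => scons (sndn (C i (fstn (sndn z))))
          (code (push (sndn (C i (fstn (sndn z))))
            (push (fstn (C i (fstn (sndn z)))) (push (N i) (Y i)))))).
      * apply comp_fst, (comp_comp _ _ HC), comp_fst, comp_snd, comp_id.
      * apply comp_scons with (T := fun i z => sndn (C i (fstn (sndn (fstn z)))))
          (K := fun _ z => sndn z)
          (g := fun i z => code (push (sndn (C i (fstn (sndn (fstn z)))))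
            (push (fstn (C i (fstn (sndn (fstn z))))) (push (N i) (Y i))))).
        -- apply comp_snd, (comp_comp _ _ HC), comp_fst, comp_snd, comp_fst, comp_id.
        -- apply (comp_code_push3 Y (fun i _ => N i)
             (fun i z => fstn (C i (fstn (sndn (fstn (fstn z))))))
             (fun i z => sndn (C i (fstn (sndn (fstn (fstn z))))))
             (fun _ z => sndn z)); [exact HY|exact HN| | |].
           ++ apply comp_fst, (comp_comp _ _ HC), comp_fst, comp_snd, comp_fst,
                comp_fst, comp_id.
           ++ apply comp_snd, (comp_comp _ _ HC), comp_fst, comp_snd, comp_fst,
                comp_fst, comp_id.
           ++ apply comp_snd, comp_id.
        -- apply comp_snd, comp_id.
      * apply comp_snd, comp_snd, comp_id.
    + intros i Hi m. unseq.
      specialize (HCs i Hi m). cbn [pushes] in HCs. unfold env in HCs. unpair.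
      split; [easy|]. cbn [map dual_quant qwitness]. unseq. split; [|easy].
      intros j. now unseq.
Qed.

End Witnesses.

Lemma comp_computable {I} (D : I -> Prop) ora f :
  computable f -> comp D ora (fun _ => f).
Proof.
  rewrite computable_iff. intros Hf.
  apply (comp_oracle D _ ora _ _ (fun _ => tt) Hf); [easy|apply comp_const].
Qed.

Lemma comp_bundle_row {I} (D : I -> Prop) (fs : I -> list baire) j :
  comp D (fun i => bundle (fs i)) (fun i => nth j (fs i) (fun _ => 0)).
Proof.
  eapply comp_ext; [apply (comp_query _ (comp_pair _ _ (comp_const j) comp_id))|].
  intros i n _. symmetry. apply bundle_pairn.
Qed.

(* [p] translates witnesses in one direction and dual witnesses in the other,
   by contraposition of the same implication; likewise for [r]. *)
Lemma dm_reducible_settled q q' phi psi (Y : instance -> instance)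
    (p r : nat -> nat) (g : nat -> nat -> nat) :
  q = Ex \/ q = AllInf -> q' = Ex \/ q' = AllInf ->
  prefix phi = [All; q; All] -> prefix psi = [All; q'; All] ->
  comp (instance_of phi) code (fun x => code (Y x)) ->
  (forall x, instance_of phi x -> instance_of psi (Y x)) ->
  computable p -> computable r -> computable (fun z => g (fstn z) (sndn z)) ->
  (forall x, instance_of phi x -> forall a t,
     settled q (matrix phi) x (p a) t ->
     settled q' (matrix psi) (Y x) a (g a t)) ->
  (forall x, instance_of phi x -> forall n t,
     settled q' (matrix psi) (Y x) (r n) t -> settled q (matrix phi) x n t) ->
  dm_reducible phi psi.
Proof.
  intros Hq Hq' Hphi Hpsi HY HYi Hp Hr Hg Hto Hfrom.
  (* Indices are pairs of an instance and a sequence; [a_ok] restricts to sequences that are genuine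
     witnesses, where alone the translation must be defined. *)
  set (D a_ok (xa : instance * baire) := instance_of phi (fst xa) /\ a_ok xa : Prop).
  set (ora (xa : instance * baire) := bundle [snd xa; code (fst xa)]).
  assert (Hx : forall ok, comp (D ok) ora (fun xa => code (fst xa))).
  { intros ok. apply (comp_bundle_row (D ok) (fun xa => [snd xa; code (fst xa)]) 1). }
  assert (Ha : forall ok, comp (D ok) ora snd).
  { intros ok. apply (comp_bundle_row (D ok) (fun xa => [snd xa; code (fst xa)]) 0). }
  assert (HYx : forall ok, comp (D ok) ora (fun xa => code (Y (fst xa)))).
  { intros ok. apply (comp_oracle _ (instance_of phi) _ code (fun x => code (Y x)) fst);
      [exact HY|now intros xa []|apply Hx]. }
  destruct HY as [eta Heta].
  exists eta. split.
  (* Row [n] of the new witness gets its value from row [p n] of the given one, converted by [g]. *)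
  - destruct (comp_witness (D := D (fun xa => witness phi (fst xa) (snd xa)))
      (ora := ora) q' (matrix psi)
      (fun xa => Y (fst xa))
      (fun xa n => g n (snd xa (pairn (p n) 0)))) as [F [[rm Hrm] HF]]; auto.
    { eapply comp_ext; [apply (comp_comp (fun _ z => g (fstn z) (sndn z))
        (fun xa n => pairn n (snd xa (pairn (p n) 0))))|].
      - now apply comp_computable.
      - apply comp_pair; [apply comp_id|].
        apply (comp_comp _ _ (Ha _)), comp_pair; [|apply (comp_const 0)].
        now apply comp_computable.
      - intros i n _. cbn beta. now unpair. }
    { intros [x a] [Hx1 Hx2] n. apply Hto; [easy|].
      apply qwitness_settled; [easy|]. unfold witness in Hx2. now rewrite Hphi in Hx2. }
    destruct (comp_witness (D := D (fun xa => witness psi (Y (fst xa)) (snd xa)))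
      (ora := ora) q (matrix phi) fst
      (fun xa n => snd xa (pairn (r n) 0))) as [G [[rp Hrp] HG]]; auto.
    { apply (comp_comp _ _ (Ha _)), comp_pair; [|apply (comp_const 0)].
      now apply comp_computable. }
    { intros [x a] [Hx1 Hx2] n. apply Hfrom; [easy|].
      apply qwitness_settled; [easy|]. unfold witness in Hx2. now rewrite Hpsi in Hx2. }
    exists rm, rp. intros x Hix. exists (Y x).
    split; [auto|]. split; [now apply Heta|]. split; [|split].
    + unfold holds. rewrite Hphi, Hpsi, !qholds_settled by easy. split.
      * intros H a. destruct (H (p a)) as [t Ht]. eauto.
      * intros H n. destruct (H (r n)) as [t Ht]. eauto.
    + intros a Hw. exists (F (x, a)). split; [now apply (Hrm (x, a))|].
      unfold witness. rewrite Hpsi. now apply (HF (x, a)).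
    + intros a Hw. exists (G (x, a)). split; [now apply (Hrp (x, a))|].
      unfold witness. rewrite Hphi. now apply (HG (x, a)).
  (* For the duals only the first entry is carried over, by [r] forwards and by [p] backwards. *)
  - destruct (comp_dual_witness
      (D := D (fun xa => witness (dual phi) (fst xa) (snd xa)))
      (ora := ora) q' (matrix psi) (fun xa => Y (fst xa)) (nnum psi)
      (fun xa => r (snd xa 0))) as [F [[rm Hrm] HF]]; auto.
    { apply (comp_comp (fun _ => r)); [now apply comp_computable|].
      apply (comp_comp _ _ (Ha _)), comp_const. }
    { intros [x a] [Hx1 _]. now apply HYi. }
    { intros [x a] [Hx1 Hx2] t Ht. apply Hfrom in Ht; [|easy]. revert Ht.
      apply qwitness_dual_settled; [easy|].
      unfold witness in Hx2. cbn [prefix dual] in Hx2. now rewrite Hphi in Hx2. }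
    destruct (comp_dual_witness
      (D := D (fun xa => witness (dual psi) (Y (fst xa)) (snd xa)))
      (ora := ora) q (matrix phi) fst (nnum phi)
      (fun xa => p (snd xa 0))) as [G [[rp Hrp] HG]]; auto.
    { apply (comp_comp (fun _ => p)); [now apply comp_computable|].
      apply (comp_comp _ _ (Ha _)), comp_const. }
    { intros [x a] [Hx1 _]. apply Hx1. }
    { intros [x a] [Hx1 Hx2] t Ht. apply Hto in Ht; [|easy]. revert Ht.
      apply qwitness_dual_settled; [easy|].
      unfold witness in Hx2. cbn [prefix dual] in Hx2. now rewrite Hpsi in Hx2. }
    exists rm, rp. intros x Hix. exists (Y x).
    split; [now apply HYi|]. split; [now apply Heta|]. split; [|split].
    + unfold holds. cbn [prefix matrix dual].
      rewrite Hphi, Hpsi, !qholds_dual_settled by easy. split.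
      * intros [n H]. exists (r n). intros t Ht. now apply (H t), Hfrom.
      * intros [a H]. exists (p a). intros t Ht. now apply (H (g a t)), Hto.
    + intros a Hw. exists (F (x, a)). split; [now apply (Hrm (x, a))|].
      unfold witness. cbn [prefix matrix dual]. rewrite Hpsi. now apply (HF (x, a)).
    + intros a Hw. exists (G (x, a)). split; [now apply (Hrp (x, a))|].
      unfold witness. cbn [prefix matrix dual]. rewrite Hphi. now apply (HG (x, a)).
Qed.

(** * The canonical formula *)

(** The argument of the function is laid out exactly as [pushes 3] unpacks a tuple, so a matrix can
    be tabulated without rearrangement. *)
Definition triple_zero : formula :=
  Formula 0 1 [All; AllInf; All]
    (BEq (TApp 0 (TPair (TVar 0) (TPair (TVar 1) (TPair (TVar 2) TZero)))) TZero)
    (fun _ => True).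

(** The parameters of [phi] are absorbed into one table of its matrix. Value [0] stands for truth,
    hence the negation. *)
Definition matrix_instance (phi : formula) (x : instance) : instance :=
  Inst [] [fun e => truth (~ bholds (matrix phi) (pushes 3 e x))].

Lemma instance_of_code phi x : instance_of phi x -> computable (code x).
Proof. intros (_ & _ & H & _). now apply computable_code. Qed.


Lemma truth_one P : truth P = 1 <-> P.
Proof. unfold truth. now destruct excluded_middle_informative. Qed.

Lemma truth_zero P : truth P = 0 <-> ~ P.
Proof. unfold truth. now destruct excluded_middle_informative. Qed.

Lemma comp_matrix_instance phi :
  comp (instance_of phi) code (fun x => code (matrix_instance phi x)).
Proof.
  apply (comp_bundle _ _ _ 1); [easy|]. intros [|[|j]]; [|exact (comp_const 0)..].
  apply decidable_not.
  apply (decidable_bholds_family (instance_of phi) code (fun x => x) (nnum phi) 3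
    (matrix phi) (fun _ e => e)).
  - apply comp_query, comp_id.
  - now intros x [].
  - apply comp_id.
Qed.

Lemma settled_matrix_instance phi x n t :
  settled AllInf (matrix triple_zero) (matrix_instance phi x) n t <->
  settled AllInf (matrix phi) x n t.
Proof.
  assert (H : forall m k,
    bholds (matrix triple_zero) (push k (push m (push n (matrix_instance phi x))))
    <-> bholds (matrix phi) (push k (push m (push n x)))).
  { intros m k.
    change (truth (~ bholds (matrix phi)
      (pushes 3 (pairn k (pairn m (pairn n 0))) x)) = 0 <->
      bholds (matrix phi) (push k (push m (push n x)))).
    rewrite truth_zero. cbn [pushes]. unpair. split; [apply NNPP|tauto]. }
  split; intros Hs m Hm k; now apply H, Hs.
Qed.

(** Serves twice: with [q = AllInf] for completeness of the canonical formula, and with [q = Ex] for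
    local finiteness, where a valid bound stays valid when increased. *)
Lemma reducible_to_triple_zero q phi :
  q = Ex \/ q = AllInf -> prefix phi = [All; q; All] ->
  (forall x, instance_of phi x -> forall n t,
     settled q (matrix phi) x n t <-> settled AllInf (matrix phi) x n t) ->
  dm_reducible phi triple_zero.
Proof.
  intros Hq Hphi Hs.
  apply (dm_reducible_settled q AllInf phi triple_zero (matrix_instance phi)
    (fun n => n) (fun n => n) (fun _ t => t)); auto.
  - apply comp_matrix_instance.
  - intros x Hx. repeat split. constructor; [|constructor].
    eapply (computable_family _ _
      (fun x => nth 0 (funs (matrix_instance phi x)) (fun _ => 0)) x);
      [|exact Hx|eapply instance_of_code, Hx].
    eapply comp_ext; [eapply comp_comp; [apply (comp_matrix_instance phi)|]|].
    + apply (comp_pair _ _ (comp_const 0) comp_id).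
    + intros y n _. symmetry. apply (bundle_pairn _ 0).
  - apply computable_iff, comp_id.
  - apply computable_iff, comp_id.
  - apply computable_iff. apply comp_snd, comp_id.
  - intros x Hx n t H. now apply settled_matrix_instance, Hs.
  - intros x Hx n t H. now apply Hs, settled_matrix_instance.
Qed.

Lemma triple_zero_dicomplete : strictly_dicomplete [All; AllInf; All] triple_zero.
Proof.
  split; [now split|]. intros psi [Hpsi _].
  now apply (reducible_to_triple_zero AllInf); [right| |].
Qed.

(** * Monotonicity of degree bounds *)

Lemma locfin_matrix_iff V E a k c :
  bholds locfin_matrix (push c (push k (push a (Inst [] [V; E])))) <->
  (V a = 1 ->
   (forall i, i <= k -> V (component c i) = 1 /\ E (pairn a (component c i)) = 1) ->
   exists i, i <= k /\ exists j, j <= k /\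
     i <> j /\ component c i = component c j).
Proof. reflexivity. Qed.

(** For [m >= t], the first [t + 1] entries of a tuple of [m + 1] neighbours already contain a
    repetition. *)
Lemma locfin_settled x :
  graph_instance x -> forall a t,
  settled Ex locfin_matrix x a t <-> settled AllInf locfin_matrix x a t.
Proof.
  intros (V & E & -> & _) a t. split; [|intros H c; exact (H t (le_n t) c)].
  intros H m Hm c. specialize (H c). rewrite locfin_matrix_iff in *.
  intros HV Hc. destruct H as (i & Hi & j & Hj & Hij); auto.
  - intros i Hi. apply Hc. lia.
  - exists i. split; [lia|]. exists j. split; [lia|easy].
Qed.

(** * The star graph *)

(** The stage [s] codes a pair [<m, k>]; a failure at [m] makes every [q] up to
    [m + 1] bad. *)
Definition bad (f : baire) (n q s : nat) : Prop :=
  q <= S (fstn s) /\ f (pairn (sndn s) (pairn (fstn s) (pairn n 0))) <> 0.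

(** The vertex [<0, n>] is the hub of a star, [<q, <n, s>>] with [q > 0] a
    potential leaf of it.  Since [s] is the least stage with [bad f n q s], the
    hub has one leaf for each [q] up to the supremum of [m + 1] over the
    failures [n, m, k]. *)
Definition spoke (f : baire) (u v : nat) : Prop :=
  fstn u = 0 /\ fstn v <> 0 /\ fstn (sndn v) = sndn u /\
  bad f (sndn u) (fstn v) (sndn (sndn v)) /\
  forall s, s <= sndn (sndn v) -> bad f (sndn u) (fstn v) s -> s = sndn (sndn v).

Definition adjacent (f : baire) (e : nat) : Prop :=
  spoke f (fstn e) (sndn e) \/ spoke f (sndn e) (fstn e).

(** Every number is a vertex, and those on no spoke are isolated; this keeps the vertex set
    trivially decidable. *)
Definition star_graph (x : instance) : instance :=
  Inst [] [fun _ => 1; fun e => truth (adjacent (nth 0 (funs x) (fun _ => 0)) e)].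

Lemma decidable_bad {I} (D : I -> Prop) ora (f N Q S : I -> baire) :
  comp D ora f -> comp D ora N -> comp D ora Q -> comp D ora S ->
  decidable D ora (fun i n => bad (f i) (N i n) (Q i n) (S i n)).
Proof.
  intros Hf HN HQ HS. apply decidable_and.
  - apply decidable_le; [exact HQ|]. now apply comp_succ, comp_fst.
  - apply decidable_not, decidable_zero, (comp_comp _ _ Hf).
    repeat apply comp_pair; auto using comp_const, comp_fst, comp_snd.
Qed.

(** A leaf carries its stage, so leastness of that stage is a bounded condition, whereas existence
    of a bad stage would need an unbounded search. *)
Lemma decidable_spoke {I} (D : I -> Prop) ora (f U V : I -> baire) :
  comp D ora f -> comp D ora U -> comp D ora V ->
  decidable D ora (fun i n => spoke (f i) (U i n) (V i n)).
Proof.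
  intros Hf HU HV.
  apply decidable_and; [|apply decidable_and;
    [|apply decidable_and; [|apply decidable_and]]].
  - now apply decidable_zero, comp_fst.
  - now apply decidable_not, decidable_zero, comp_fst.
  - now apply decidable_eq; [apply comp_fst|]; apply comp_snd.
  - apply decidable_bad; [exact Hf|apply comp_snd, HU|apply comp_fst, HV|].
    apply comp_snd, comp_snd, HV.
  - apply (decidable_ball (fun i n s => bad (f i) (sndn (U i n)) (fstn (V i n)) s ->
      s = sndn (sndn (V i n)))); [|now apply comp_snd, comp_snd].
    assert (HU' : comp D ora (fun i z => U i (sndn z))).
    { apply (comp_comp _ _ HU), comp_snd, comp_id. }
    assert (HV' : comp D ora (fun i z => V i (sndn z))).
    { apply (comp_comp _ _ HV), comp_snd, comp_id. }
    apply decidable_imp; [apply decidable_bad|apply decidable_eq];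
      auto using comp_fst, comp_snd, comp_id.
Qed.

Lemma comp_fun {I} (D : I -> Prop) (X : I -> instance) ora j nn :
  comp D ora (fun i => code (X i)) -> (forall i, D i -> length (nums (X i)) = nn) ->
  comp D ora (fun i => nth j (funs (X i)) (fun _ => 0)).
Proof.
  intros HX Hn. eapply comp_ext.
  - apply (comp_comp _ (fun _ m => nn + pairn j m) HX).
    apply (comp_add _ _ (comp_const nn)), (comp_pair _ _ (comp_const j) comp_id).
  - intros i m Hi. cbn beta. rewrite <- (Hn i Hi), code_funs. symmetry.
    apply bundle_pairn.
Qed.

Lemma comp_star_graph phi j :
  comp (instance_of phi) code (fun x => nth j (funs (star_graph x)) (fun _ => 0)).
Proof.
  assert (Hf : comp (instance_of phi) code
    (fun x => nth 0 (funs x) (fun _ => 0))).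
  { apply (comp_fun _ (fun x => x) _ _ (nnum phi)); [|now intros x []].
    apply comp_query, comp_id. }
  destruct j as [|[|[|j]]]; [exact (comp_const 1)| |exact (comp_const 0)..].
  apply decidable_or; apply decidable_spoke; auto using comp_fst, comp_snd, comp_id.
Qed.

Lemma star_graph_instance x :
  instance_of triple_zero x -> instance_of LocFin_G (star_graph x).
Proof.
  intros Hx. split; [easy|]. split; [easy|]. split.
  - assert (H : forall j, computable (nth j (funs (star_graph x)) (fun _ => 0))).
    { intros j. apply (computable_family _ _ _ x (comp_star_graph _ j) Hx).
      eapply instance_of_code, Hx. }
    constructor; [apply (H 0)|]. constructor; [apply (H 1)|constructor].
  - set (f := nth 0 (funs x) (fun _ => 0)).
    exists (fun _ => 1), (fun e => truth (adjacent f e)). split; [easy|].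
    split; [now right|]. split; [|split; [easy|]].
    + intros e. unfold truth. destruct excluded_middle_informative; auto.
    + intros a b. rewrite !truth_one. unfold adjacent. unpair. tauto.
Qed.

Lemma settled_star_graph x a t :
  settled Ex locfin_matrix (star_graph x) a t <->
  forall c,
  (forall i, i <= t ->
     adjacent (nth 0 (funs x) (fun _ => 0)) (pairn a (component c i))) ->
  exists i, i <= t /\ exists j, j <= t /\ i <> j /\ component c i = component c j.
Proof.
  split; intros H c; specialize (H c); cbv beta in *;
    unfold star_graph in *; rewrite locfin_matrix_iff in *.
  - intros Hc. apply H; [easy|]. intros i Hi. split; [easy|].
    now apply truth_one, Hc.
  - intros _ Hc. apply H. intros i Hi. apply truth_one, Hc, Hi.
Qed.

Lemma settled_triple_zero x n t :
  settled AllInf (matrix triple_zero) x n t <->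
  forall m, t <= m -> forall k,
    nth 0 (funs x) (fun _ => 0) (pairn k (pairn m (pairn n 0))) = 0.
Proof. destruct x. reflexivity. Qed.

(** * Degrees of hubs and leaves *)

(** Finite choice, by induction on [t]: the value for [0] is paired in front of a tuple for the
    shifted relation. *)
Lemma exists_components t (R : nat -> nat -> Prop) :
  (forall i, i <= t -> exists v, R i v) ->
  exists c, forall i, i <= t -> R i (component c i).
Proof.
  revert R. induction t as [|t IH]; intros R H.
  - destruct (H 0 (le_n 0)) as [v Hv]. exists (pairn v 0). intros i Hi.
    replace i with 0 by lia. unfold component. cbn [Nat.iter nat_rect]. now unpair.
  - destruct (H 0 (Nat.le_0_l _)) as [v Hv].
    destruct (IH (fun i => R (S i))) as [c Hc].
    { intros i Hi. apply H. lia. }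
    exists (pairn v c). intros [|i] Hi.
    + unfold component. cbn [Nat.iter nat_rect]. now unpair.
    + unfold component. rewrite Nat.iter_succ_r. unpair. apply Hc. lia.
Qed.

(** Without a repetition, the [t + 1] values would form a duplicate-free list inside [seq 1 t],
    which has length [t]. *)
Lemma pigeonhole t (c : nat -> nat) :
  (forall i, i <= t -> 1 <= c i <= t) ->
  exists i, i <= t /\ exists j, j <= t /\ i <> j /\ c i = c j.
Proof.
  intros Hc. apply NNPP. intros H.
  assert (Hd : NoDup (map c (seq 0 (S t)))).
  { apply NoDup_map_NoDup_ForallPairs; [|apply seq_NoDup].
    intros i j Hi%in_seq Hj%in_seq Hij. apply NNPP. intros Hne. apply H.
    exists i. split; [lia|]. exists j. split; [lia|easy]. }
  apply NoDup_incl_length with (l' := seq 1 t) in Hd.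
  - rewrite length_map, !length_seq in Hd. lia.
  - intros q [i [<- Hi%in_seq]]%in_map_iff. apply in_seq.
    specialize (Hc i). lia.
Qed.

(** Hub and label determine the least bad stage, hence the whole leaf. *)
Lemma spoke_unique f u v v' :
  spoke f u v -> spoke f u v' -> fstn v = fstn v' -> v = v'.
Proof.
  intros (_ & _ & Hn & Hb & Hl) (_ & _ & Hn' & Hb' & Hl') Hq.
  assert (Hs : sndn (sndn v) = sndn (sndn v')).
  { rewrite Hq in *.
    destruct (Nat.le_ge_cases (sndn (sndn v)) (sndn (sndn v'))) as [H|H].
    - now apply Hl'.
    - symmetry. now apply Hl. }
  rewrite <- (pairn_fst_snd v), <- (pairn_fst_snd v'), Hq.
  rewrite <- (pairn_fst_snd (sndn v)), <- (pairn_fst_snd (sndn v')).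
  congruence.
Qed.

Lemma spoke_exists f n q s :
  q <> 0 -> bad f n q s -> exists v, spoke f (pairn 0 n) v /\ fstn v = q.
Proof.
  intros Hq. induction s as [s IH] using lt_wf_ind. intros Hs.
  destruct (classic (exists r, r < s /\ bad f n q r)) as [[r [Hr Hb]]|H].
  - eauto.
  - exists (pairn q (pairn n s)). split; [|now unpair].
    unfold spoke. unpair. repeat split; auto; try apply Hs.
    intros r Hr Hb. destruct (Nat.eq_dec r s); [easy|].
    destruct H. exists r. split; [lia|easy].
Qed.

(** If all failures of a hub lie below [t], its leaves have labels in [1], ..., [t], and each label
    occurs once. A vertex with nonzero first component can only be adjacent to its hub. *)
Lemma star_bound x a t :
  settled AllInf (matrix triple_zero) x (sndn a) t ->
  settled Ex locfin_matrix (star_graph x) a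
    (match fstn a with 0 => t | S _ => 1 end).
Proof.
  rewrite settled_triple_zero, settled_star_graph. intros H c Hc.
  set (f := nth 0 (funs x) (fun _ => 0)) in *. unfold adjacent in Hc.
  destruct (fstn a) as [|q] eqn:Ea.
  - assert (Hsp : forall i, i <= t -> spoke f a (component c i)).
    { intros i Hi. specialize (Hc i Hi). unpair.
      destruct Hc as [Hc|(_ & Hc & _)]; congruence. }
    destruct (pigeonhole t (fun i => fstn (component c i))) as (i & Hi & j & Hj & Hij).
    (* The label is nonzero and at most [m + 1] for a failure at some [m]; as [m < t], it is at most
       [t]. *)
    { intros i Hi. destruct (Hsp i Hi) as (_ & H0 & _ & [Hb Hne] & _).
      destruct (Nat.le_gt_cases t (fstn (sndn (sndn (component c i))))) as [Ht|Ht].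
      - destruct Hne. now apply H.
      - lia. }
    exists i. split; [easy|]. exists j. split; [easy|]. split; [easy|].
    apply (spoke_unique f a); auto. apply Hij.
  - assert (Hsp : forall i, i <= 1 -> component c i = pairn 0 (fstn (sndn a))).
    { intros i Hi. specialize (Hc i Hi). unpair.
      destruct Hc as [(Hc & _)|(H0 & _ & H1 & _)]; [congruence|].
      now rewrite <- (pairn_fst_snd (component c i)), H0, H1. }
    exists 0. split; [lia|]. exists 1. split; [lia|]. split; [easy|].
    rewrite !Hsp; auto.
Qed.

(** A failure at some [m >= t] makes the labels [1], ..., [t + 1] bad, which yields [t + 1] distinct
    leaves and contradicts the degree bound [t]. *)
Lemma hub_bound x n t :
  settled Ex locfin_matrix (star_graph x) (pairn 0 n) t ->
  settled AllInf (matrix triple_zero) x n t.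
Proof.
  rewrite settled_triple_zero, settled_star_graph. intros H m Hm k.
  set (f := nth 0 (funs x) (fun _ => 0)) in *. apply NNPP. intros Hne.
  destruct (exists_components t
    (fun i v => spoke f (pairn 0 n) v /\ fstn v = S i)) as [c Hc].
  { intros i Hi. apply spoke_exists with (s := pairn m k); [easy|].
    unfold bad. unpair. split; [lia|easy]. }
  destruct (H c) as (i & Hi & j & Hj & Hij & Hcc).
  - intros i Hi. left. unpair. now apply Hc.
  - apply Hc in Hi as [_ Hi], Hj as [_ Hj]. rewrite Hcc in Hi. lia.
Qed.

(** * Both reductions for local finiteness *)

Lemma triple_zero_reducible_to_LocFin : dm_reducible triple_zero LocFin_G.
Proof.
  (* Row [n] is read off at the hub [pairn 0 n]. A hub inherits the threshold of its row as degree
     bound; any other vertex gets the bound [1]. *)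
  apply (dm_reducible_settled AllInf Ex triple_zero LocFin_G star_graph
    sndn (pairn 0) (fun a t => match fstn a with 0 => t | S _ => 1 end)); auto.
  - apply (comp_bundle _ _ _ 2); [easy|]. apply comp_star_graph.
  - apply star_graph_instance.
  - apply computable_iff, comp_snd, comp_id.
  - apply computable_iff, (comp_pair _ _ (comp_const 0) comp_id).
  - apply computable_iff.
    apply (comp_case (fun _ z => sndn z) (fun _ _ _ => 1) (fun _ z => fstn (fstn z)));
      [apply comp_snd, comp_id|apply comp_const|apply comp_fst, comp_fst, comp_id].
  - intros x _. apply star_bound.
  - intros x _. apply hub_bound.
Qed.

Theorem proposition3p3 : dicomplete [All; AllInf; All] LocFin_G.
Proof.
  exists triple_zero. split; [apply triple_zero_dicomplete|]. split.
  - apply (reducible_to_triple_zero Ex); auto.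
    intros x (_ & _ & _ & Hx). now apply locfin_settled.
  - apply triple_zero_reducible_to_LocFin.
Qed.
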